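(* Let $P_\sigma(T)$ be a Veronese $d$-polytope with induced circular composition $(\mathring T,\mathring D)$ and structure map $\tau:T\to\mathring T$. If $|\mathring D|<d$, then every generating point $\nu_d(t)/q_\xi(t)$, $t\in T$, is a vertex of $P_\sigma(T)$. If $|\mathring D|=d$, then the vertices of $P_\sigma(T)$ are exactly the generating points $\nu_d(t)/q_\xi(t)$ with $\tau(t)$ contained in some divider of $\mathring D$.
   Context: Setting: $d\ge1$, $T=\{t_1<\dots<t_n\}\subset\mathbb R$ with $n\ge d+1$, $\nu_d(t)=(1,t,\dots,t^d)$, $q_\xi(t)=\sum_{i=0}^d\xi_it^i$. A chamber $\sigma$ is the closure of a connected component of the complement in $\mathbb R^{d+1}$ of the hyperplanes $\{\xi:q_\xi(t)=0\}$, $t\in T$; $P_\sigma(T)=\mathrm{conv}\{\nu_d(t)/q_\xi(t):t\in T\}$ for $\xi$ in the interior of $\sigma$ (a $d$-polytope whose combinatorial type depends only on $\sigma$); the points $\nu_d(t)/q_\xi(t)$ are the generating points. The signed $\sigma$-decomposition partitions $T$ into maximal runs $I_1<\dots<I_{k+1}$ of consecutive elements on which $\mathrm{sgn}\,q_\xi$ is constant; $I_j=\{t_{j,1}<\dots<t_{j,n_j}\}$. Induced circular composition: $\tau$ is a bijection from $T$ onto an $n$-element set $\mathring T$ cyclically ordered so that $\tau(t_{i+1})$ comes consecutively after $\tau(t_i)$ and $\tau(t_1)$ after $\tau(t_n)$; the set of dividers $\mathring D$ consists of the pairs $\{\tau(t_{j,n_j}),\tau(t_{j+1,1})\}$, $j\in[k]$,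 together with $\{\tau(t_{k+1,n_{k+1}}),\tau(t_{1,1})\}$ exactly when $d$ and $k$ have different parities. *)

(* Defs.v *)
From HB Require Import structures.
From mathcomp Require Import all_boot all_order all_algebra.
From mathcomp Require Import all_classical reals topology normedtype convex.

Set Implicit Arguments.
Unset Strict Implicit.
Unset Printing Implicit Defensive.

Import Order.TTheory GRing.Theory Num.Theory.
Import numFieldNormedType.Exports.

Local Open Scope classical_set_scope.
Local Open Scope ring_scope.

Section ConvexHull.
Variables (R : realType) (m : nat).
Implicit Types (P F : set 'rV[R]_m) (v : 'rV[R]_m).

Definition convex_hull (A : set 'rV[R]_m) : set 'rV[R]_m :=
  smallest (@convex_set R 'rV[R]_m) A.

Definition is_face P F : Prop :=
  exists (c : 'cV[R]_m) (b : R),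
    (forall x, P x -> (x *m c) 0 0 <= b) /\
    F = P `&` [set x | (x *m c) 0 0 = b].

(* A vertex is a 0-dimensional face, i.e. a face consisting of one point. *)
Definition is_vertex P v : Prop := is_face P [set v].

End ConvexHull.

(* A finite set T = {t_1 < ... < t_n} of reals is given by the sequence      *)
(* T : seq R of its elements in increasing order, i.e. by a sequence T with  *)
(* sorted <%R T; then n = size T.                                            *)
Section Veronese.
Variables (R : realType) (d : nat).
Implicit Types (T : seq R) (xi : 'rV[R]_d.+1) (sigma : set 'rV[R]_d.+1).

Definition veronese (t : R) : 'rV[R]_d.+1 := \row_(i < d.+1) t ^+ i.

Definition qpoly xi (t : R) : R := \sum_(i < d.+1) xi 0 i * t ^+ i.

Definition hyperplane_complement T : set 'rV[R]_d.+1 :=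
  ~` \bigcup_(t in [set` T]) [set xi | qpoly xi t = 0].

Definition is_chamber T sigma : Prop :=
  exists2 xi, hyperplane_complement T xi &
    sigma = closure (connected_component (hyperplane_complement T) xi).

Definition generating_point xi (t : R) : 'rV[R]_d.+1 :=
  (qpoly xi t)^-1 *: veronese t.

(* P_sigma(T), computed from a point xi of the interior of sigma. *)
Definition veronese_polytope T xi : set 'rV[R]_d.+1 :=
  convex_hull (generating_point xi @` [set` T]).

(* I = [:: I_1; ...; I_(k+1)]; maximality of the runs amounts to the sign    *)
(* changing from each run to the next one.                                   *)
Definition is_signed_decomposition T xi (I : seq (seq R)) : Prop :=
  [/\ flatten I = T,
      [::] \notin I,
      {in I, forall B, {in B &, forall s t,
         Num.sg (qpoly xi s) = Num.sg (qpoly xi t)}} &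
      sorted (fun A B => Num.sg (qpoly xi (last 0 A))
                           != Num.sg (qpoly xi (head 0 B))) I].

End Veronese.

Section CircularComposition.
Variable S : finType.
Implicit Types (c : S -> S -> S -> bool) (x y z w : S).

Definition is_cyclic_order c : Prop :=
  [/\ forall x y z, c x y z -> c y z x,
      forall x y z, c x y z -> ~~ c z y x,
      forall x y z w, c x y z -> c x z w -> c x y w &
      forall x y z, x != y -> y != z -> z != x -> c x y z || c z y x].

(* y comes consecutively after x. *)
Definition consecutive c : rel S :=
  fun x y => (x != y) && [forall z, ~~ c x z y].

Variables (R : realType).
Implicit Types (T : seq R) (tau : R -> S).

(* The values of tau outside T are irrelevant. *)
Definition is_structure_map T c tau : Prop :=
  [/\ {in T &, injective tau},
      forall x, x \in [seq tau t | t <- T] &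
      cycle (consecutive c) [seq tau t | t <- T]].

(* Runs are indexed from 0 here: nth [::] I j is I_(j+1), and k + 1 is the   *)
(* number of runs.                                                           *)
Definition dividers (d : nat) (I : seq (seq R)) tau : {set {set S}} :=
  let k := (size I).-1 in
  ([set [set tau (last 0 (nth [::] I j)); tau (head 0 (nth [::] I j.+1))]
     | j : 'I_k]
   :|: (if odd d != odd k then
          [set [set tau (last 0 (nth [::] I k)); tau (head 0 (nth [::] I 0))]]
        else finset.set0))%SET.

(* The circular composition (S, D), where S carries the cyclic order c. *)
Definition is_induced_circular_composition (d : nat) T (xi : 'rV[R]_d.+1)
    c (D : {set {set S}}) tau : Prop :=
  [/\ is_cyclic_order c,
      is_structure_map T c tau &
      exists2 I, is_signed_decomposition T xi I & D = dividers d I tau].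

End CircularComposition.

(* Main.v *)
Require Import Defs.
From HB Require Import structures.
From mathcomp Require Import all_boot all_order all_algebra.
From mathcomp Require Import unstable all_classical reals interval_inference.
From mathcomp Require Import topology normedtype convex.

(* On the hyperplane [xi . x = 1] containing the polytope, affine functions are
   the quotients [f / q_xi] with [f] a polynomial of degree at most [d]. Hence
   the point of parameter [t] is a vertex iff some such [f] vanishes at [t] and
   has the sign of [q_xi] at all other points of [T]. Such an [f] is built from
   one root in each of the [k] gaps where [q_xi] changes sign, times [(X - t)^2]
   if [k + 2 <= d]; when [t] is an endpoint of a gap the root of that gap is put
   at [t], and when [k + 1 = d] and [t] is extreme in [T] the factor
   [+-(X - t)] is free of sign changes. Conversely, when the circular
   composition has [d] dividers, i.e. [k] is [d] or [d - 1], and [t] lies in no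
   divider, [f] has [k + 1] distinct roots, [t] and one in each gap: too many if
   [k = d], and if [k = d - 1] then [f] is their product and [X - t] spoils the
   signs. *)

Set Implicit Arguments.
Unset Strict Implicit.
Unset Printing Implicit Defensive.

Import Order.TTheory GRing.Theory Num.Theory.
Import numFieldNormedType.Exports.

Local Open Scope classical_set_scope.
Local Open Scope ring_scope.

(* [all_algebra] also exports an unrelated [qpoly]. *)
Local Notation qpoly := Defs.qpoly.

(** * Sign changes along an increasing list *)

Section SignChanges.
Variable R : realDomainType.
Implicit Types (q : R -> R) (x t : R) (s : seq R) (p : R * R) (g : R * R -> R).

Lemma le_path_last x s t :
  path <%R x s -> t \in x :: s -> t <= last x s.
Proof.
elim: s x t => [|y s ih] x t /=; first by rewrite inE => _ /eqP ->.
move=> /andP[xy ys]; rewrite inE => /predU1P[->|]; last exact: ih.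
exact: le_trans (ltW xy) (ih _ _ ys (mem_head _ _)).
Qed.

(** The list is passed as head [x] and tail [s], which makes it nonempty. Each pair gives the two
    ends of a gap between consecutive runs. *)
Fixpoint sign_changes q x s : seq (R * R) :=
  if s is y :: s' then
    if Num.sg (q x) == Num.sg (q y) then sign_changes q y s'
    else (x, y) :: sign_changes q y s'
  else [::].

Lemma mem_sign_changes q x s p : path <%R x s -> p \in sign_changes q x s ->
  [/\ p.1 \in x :: s, p.2 \in x :: s, p.1 < p.2
    & Num.sg (q p.1) != Num.sg (q p.2)].
Proof.
elim: s x => // y s ih x /= /andP[xy ys].
have hrec : p \in sign_changes q y s ->
    [/\ p.1 \in x :: y :: s, p.2 \in x :: y :: s, p.1 < p.2
      & Num.sg (q p.1) != Num.sg (q p.2)].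
  by case/(ih _ ys) => p1 p2 ? ?; split=> //; rewrite inE ?p1 ?p2 orbT.
case: ifPn => // sxy; rewrite inE => /orP[/eqP -> /=|//].
by split; rewrite ?inE ?eqxx ?orbT.
Qed.

(** Serves to show that a root strictly inside a gap is never an element of the list. *)
Lemma sign_changes_consecutive q x s p t : path <%R x s ->
  p \in sign_changes q x s -> t \in x :: s -> (t <= p.1) || (p.2 <= t).
Proof.
elim: s x => // y s ih x /= /andP[xy ys].
have y_le u : u \in y :: s -> y <= u.
  rewrite inE => /predU1P[-> //|us].
  by move: ys; rewrite lt_path_sortedE => /andP[/allP/(_ _ us)/ltW].
have hrec : p \in sign_changes q y s -> t \in x :: y :: s ->
    (t <= p.1) || (p.2 <= t).
  move=> pin; rewrite inE => /predU1P[->|]; last exact: ih pin.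
  have [p1 _ _ _] := mem_sign_changes ys pin.
  by rewrite (le_trans (ltW xy)) ?y_le.
case: ifPn => // _; rewrite inE => /predU1P[-> /=|//].
by rewrite inE => /predU1P[->|/y_le ->]; rewrite ?lexx ?orbT.
Qed.

Lemma sign_changes_uniq q x s : path <%R x s -> uniq (sign_changes q x s).
Proof.
elim: s x => // y s ih x /= /andP[xy ys]; case: ifP => _ /=; rewrite ih ?andbT//.
apply/negP => /(mem_sign_changes ys)[/= + _ _ _].
rewrite inE => /predU1P[e|xs]; first by rewrite e ltxx in xy.
move: ys; rewrite lt_path_sortedE => /andP[/allP/(_ _ xs) yx _].
by have := lt_trans xy yx; rewrite ltxx.
Qed.

(** The ends of each gap are list elements, so none of them lies strictly inside the other gap; a
    common interior point then forces both ends to agree. *)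
Lemma sign_changes_disjoint q x s g p1 p2 : path <%R x s ->
  (forall p, p \in sign_changes q x s -> p.1 < g p < p.2) ->
  p1 \in sign_changes q x s -> p2 \in sign_changes q x s ->
  g p1 = g p2 -> p1 = p2.
Proof.
move=> xs hg h1 h2 e.
have [/andP[a1 b1] /andP[a2 b2]] := (hg _ h1, hg _ h2); rewrite -{}e in a2 b2.
have [m11 m12 _ _] := mem_sign_changes xs h1.
have [m21 m22 _ _] := mem_sign_changes xs h2.
have c := sign_changes_consecutive xs.
have sep y z : z <= y -> y < g p1 -> g p1 < z -> False.
  by move=> zy yg gz; have := lt_trans yg (lt_le_trans gz zy); rewrite ltxx.
case: p1 p2 h1 h2 a1 b1 a2 b2 m11 m12 m21 m22 sep.
move=> u1 v1 [u2 v2] /= h1 h2 a1 b1 a2 b2 m11 m12 m21 m22 sep.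
have E1 : u1 = u2.
  apply/eqP; rewrite eq_le.
  case/orP: (c _ _ _ h1 m21) => [-> |/sep]; last by move=> /(_ a2 b1).
  by case/orP: (c _ _ _ h2 m11) => [->|/sep /(_ a1 b2)].
have E2 : v1 = v2.
  apply/eqP; rewrite eq_le.
  case/orP: (c _ _ _ h1 m22) => /= [/sep /(_ a1 b2)//|->].
  by case/orP: (c _ _ _ h2 m12) => [/sep /(_ a2 b1)|->].
by rewrite E1 E2.
Qed.

(** The factor of a gap is negative before the gap and positive after it, and [q] changes sign
    exactly at the gaps, so the product and [q] agree in sign up to a constant. At [x] all factors
    are negative, which fixes the constant. The bounds on [g] are weak so that a root may sit at an
    end of its gap. *)
Lemma sgr_prod_sign_changes q x s g t : path <%R x s ->
  {in x :: s, forall u, q u != 0} ->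
  (forall p, p \in sign_changes q x s -> p.1 <= g p <= p.2) ->
  t \in x :: s -> (forall p, p \in sign_changes q x s -> t != g p) ->
  Num.sg (\prod_(p <- sign_changes q x s) (t - g p)) =
    (-1) ^+ size (sign_changes q x s) * Num.sg (q x) * Num.sg (q t).
Proof.
elim: s x => [|y s ih] x /=.
  move=> _ q0 _; rewrite !inE => /eqP -> _.
  by rewrite big_nil mul1r sgr1 -expr2 sqr_sg q0 ?inE ?eqxx.
move=> /andP[xy ys] q0 hg tin ht.
have q0' : {in y :: s, forall u, q u != 0}.
  by move=> u us; apply: q0; rewrite inE us orbT.
have sgsq u : q u != 0 -> Num.sg (q u) * Num.sg (q u) = 1.
  by move=> qu; rewrite -expr2 sqr_sg qu.
have xq : Num.sg (q x) * Num.sg (q x) = 1 by rewrite sgsq ?q0 ?inE ?eqxx.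
pose sc := sign_changes q y s.
have hx : {subset sc <= sign_changes q x (y :: s)} -> t = x ->
   Num.sg (\prod_(p <- sc) (t - g p)) = (-1) ^+ size sc.
  move=> sub -> {tin ht}.
  have : forall p, p \in sc -> x - g p < 0.
    move=> p pin; rewrite subr_lt0.
    have /andP[+ _] := hg _ (sub _ pin); apply: lt_le_trans.
    have [+ _ _ _] := mem_sign_changes ys pin.
    rewrite inE => /predU1P[-> //|ps].
    by move: ys; rewrite lt_path_sortedE => /andP[/allP/(_ _ ps) + _]; apply: lt_trans.
  elim: sc {sub} => [|p l ihl] hl; first by rewrite big_nil sgr1.
  rewrite big_cons sgrM ihl ?exprS ?(ltr0_sg (hl p _)) ?inE ?eqxx//.
  by move=> r rl; apply: hl; rewrite inE rl orbT.
move: hg ht hx; rewrite /=; case: ifPn => [/eqP sxy|sxy] hg ht hx.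
  move: tin; rewrite inE => /predU1P[tx|tin].
    by rewrite -/sc hx // tx -mulrA xq mulr1.
  by rewrite ih // sxy.
(* Nonzero values with different signs have opposite signs. *)
have sN : Num.sg (q y) = - Num.sg (q x).
  move: sxy (q0 x) (q0 y); rewrite !inE !eqxx orbT => + /(_ isT) + /(_ isT).
  by case: (sgrP (q x)); case: (sgrP (q y)); rewrite ?opprK ?eqxx.
rewrite big_cons sgrM /= exprS.
have hr : {subset sc <= (x, y) :: sign_changes q y s} by move=> p; rewrite inE orbC => ->.
have /andP[/= gx gy] := hg (x, y) (mem_head _ _).
have tg := ht (x, y) (mem_head _ _).
move: tin; rewrite inE => /predU1P[tx|tin].
  rewrite -/sc hx // tx -[RHS]mulrA xq mulr1 ltr0_sg // subr_lt0 lt_neqAle gx andbT.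
  by rewrite -{1}tx.
rewrite ih // => [|p pin|p pin]; [|by rewrite hg ?hr|by rewrite ht ?hr].
rewrite gtr0_sg; last first.
  rewrite subr_gt0 lt_neqAle eq_sym tg; apply: le_trans gy _.
  move: tin; rewrite inE => /predU1P[-> //|us].
  by move: ys; rewrite lt_path_sortedE => /andP[/allP/(_ _ us)/ltW].
by rewrite sN mul1r mulN1r !mulrN !mulNr.
Qed.

End SignChanges.

(** * Roots in the gaps *)

Lemma poly_root_between (R : rcfType) (f : {poly R}) (a b : R) :
  a < b -> f.[a] * f.[b] < 0 -> exists2 r, a < r < b & root f r.
Proof.
move=> ab fab.
have fa : f.[a] != 0 by apply: contraTneq fab => ->; rewrite mul0r ltxx.
have fb : f.[b] != 0 by apply: contraTneq fab => ->; rewrite mulr0 ltxx.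
(* The factor [- f.[a]] makes the value at [a] negative and the one at [b] positive, whatever the
   sign of [f.[a]]. *)
have [|r /andP[ar rb]] := @poly_ivt R (- f.[a] *: f) a b (ltW ab).
  rewrite !hornerZ !mulNr oppr_le0 -expr2 sqr_ge0 oppr_ge0.
  exact: ltW.
rewrite rootZ ?oppr_eq0 // => rr; exists r => //.
by rewrite !lt_neqAle ar rb !andbT; apply/andP; split;
  apply: contraTneq rr => e; rewrite /root ?e // -e.
Qed.

Lemma sign_changes_roots (R : realType) (q : R -> R) (x : R) (s : seq R)
    (f : {poly R}) : path <%R x s ->
  (forall p, p \in sign_changes q x s -> f.[p.1] * f.[p.2] < 0) ->
  exists g : R * R -> R,
    [/\ forall p, p \in sign_changes q x s -> p.1 < g p < p.2,
      all (root f) (map g (sign_changes q x s))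
    & uniq (map g (sign_changes q x s))].
Proof.
move=> xs hf.
have [p|g hg] := @choice _ _ (fun p r => p \in sign_changes q x s ->
    (p.1 < r < p.2) && root f r).
  (* Outside the list of gaps the value 0 is arbitrary. *)
  have [pin|] := boolP (p \in sign_changes q x s); last by exists 0.
  have [_ _ lt_p _] := mem_sign_changes xs pin.
  by have [r hr fr] := poly_root_between lt_p (hf _ pin); exists r => _; apply/andP.
have hg1 p : p \in sign_changes q x s -> p.1 < g p < p.2 by case/hg/andP.
exists g; split=> //.
  by apply/allP => _ /mapP[p pin ->]; case/andP: (hg _ pin).
rewrite map_inj_in_uniq ?sign_changes_uniq // => p1 p2 h1 h2.
exact: (sign_changes_disjoint xs hg1).
Qed.

(** * Vertices of a convex hull *)

Section Vertices.
Variables (R : realType) (m : nat).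
Implicit Types (A : set 'rV[R]_m) (u v : 'rV[R]_m) (c : 'cV[R]_m) (b : R).

Lemma conv_mulmx c (x y : convex_lmodType 'rV[R]_m) (l : {i01 R}) :
  (conv l x y *m c) 0 0 =
  l%:num * (x *m c) 0 0 + (l%:num).~ * (y *m c) 0 0.
Proof.
rewrite [X in X *m _]/(l%:num *: x + (l%:num).~ *: y).
by rewrite mulmxDl -!scalemxAl !mxE.
Qed.

Lemma convex_halfspace c b : convex_set [set x : 'rV[R]_m | (x *m c) 0 0 < b].
Proof.
apply/convex_setW => x y + + l l0 l1; rewrite !inE /= => xb yb.
rewrite conv_mulmx.
have -> : b = l%:num * b + (l%:num).~ * b by rewrite -mulrDl add_onemK mul1r.
by rewrite ltrD // ltr_pM2l // onem_gt0.
Qed.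

(** Here [v] lies on the boundary hyperplane. A proper convex combination is strictly inside as soon
    as one of its two points is; otherwise both are [v]. *)
Lemma convex_halfspaceU1 c v :
  convex_set ([set x : 'rV[R]_m | (x *m c) 0 0 < (v *m c) 0 0] `|` [set v]).
Proof.
apply/convex_setW => x y + + l l0 l1; rewrite !inE /= => hx hy.
have le z : (z *m c) 0 0 < (v *m c) 0 0 \/ z = v -> (z *m c) 0 0 <= (v *m c) 0 0.
  by case=> [/ltW|->].
have l0' : 0 < (l%:num).~ by rewrite onem_gt0.
have e : (v *m c) 0 0 = l%:num * (v *m c) 0 0 + (l%:num).~ * (v *m c) 0 0.
  by rewrite -mulrDl add_onemK mul1r.
case: hx (le _ hx) => [hx _|-> _].
  left; rewrite conv_mulmx e.
  by rewrite ltr_leD ?ltr_pM2l ?ler_pM2l ?le.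
case: hy => [hy|->].
  by left; rewrite conv_mulmx {2}e ltrD2l ltr_pM2l.
by right; rewrite /= convmm.
Qed.

(** Every convex set containing [A] contains the hull. An open half-space shows that a vertex
    belongs to [A]; an open half-space with [v] adjoined shows that a strict maximizer over [A] is
    the only maximizer over the hull. *)
Lemma is_vertex_hullP A v :
  is_vertex (convex_hull A) v <->
  A v /\ exists c, forall u, A u -> u != v -> (u *m c) 0 0 < (v *m c) 0 0.
Proof.
split=> [[c [b [hb vE]]]|[Av [c hc]]].
  have [Pv vb] : convex_hull A v /\ (v *m c) 0 0 = b.
    by have : [set v] v by []; rewrite vE.
  have lt_b u : A u -> u != v -> (u *m c) 0 0 < b.
    move=> Au uv; rewrite lt_neqAle hb ?andbT; last exact: sub_gen_smallest.
    apply: contra_neq uv => ub.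
    suff : [set v] u by []; rewrite vE; split=> //; exact: sub_gen_smallest.
  split; last by exists c => u; rewrite vb; apply: lt_b.
  apply: contrapT => Av.
  have /(_ v Pv)/= : convex_hull A `<=` [set x | (x *m c) 0 0 < b].
    apply: smallest_sub; first exact: convex_halfspace.
    by move=> u Au /=; apply: lt_b => //; apply: contra_notN Av => /eqP <-.
  by rewrite vb ltxx.
have sub : convex_hull A `<=`
    [set x : 'rV[R]_m | (x *m c) 0 0 < (v *m c) 0 0] `|` [set v].
  apply: smallest_sub; first exact: convex_halfspaceU1.
  by move=> u Au; have [->|uv] := eqVneq u v; [right|left; apply: hc].
exists c, ((v *m c) 0 0); split=> [x /sub[/ltW//|->//]|].
apply/seteqP; split=> [_ ->|x [/sub[/= xv e|//]]].
  by split=> //; exact: sub_gen_smallest.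
by rewrite e ltxx in xv.
Qed.

End Vertices.

(** * Signs of [q_xi] on a chamber *)

Section Chambers.
Variables (R : realType) (d : nat).
Implicit Types (T : seq R) (xi : 'rV[R]_d.+1) (sigma : set 'rV[R]_d.+1).

Lemma qpoly_continuous t : continuous (fun xi : 'rV[R]_d.+1 => qpoly xi t).
Proof.
have -> : (fun xi : 'rV[R]_d.+1 => qpoly xi t) =
    \sum_(i < d.+1) (fun xi : 'rV[R]_d.+1 => xi 0 i * t ^+ i).
  by apply/funext => xi; rewrite fct_sumE.
apply: (@big_ind _ (fun f : 'rV[R]_d.+1 -> R => continuous f)) => [|f g cf cg xi|i _ xi].
- exact: cst_continuous.
- by apply: continuousD; [exact: cf|exact: cg].
- apply: (@cvgMr_tmp _ _ (nbhs xi) _ (fun M : 'rV[R]_d.+1 => M 0 i)).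
  exact: coord_continuous.
Qed.

(** The value at [t] is continuous in [xi] and nonzero on the component, so its image there is an
    interval missing 0. Only the weak inequality passes to the closure. *)
Lemma closure_component_sign T xi0 t : t \in T ->
  exists2 e : R, e != 0 &
    closure (connected_component (hyperplane_complement T) xi0) `<=`
    [set xi | 0 <= e * qpoly xi t].
Proof.
move=> tT; set C := connected_component _ _.
have Cq xi : C xi -> qpoly xi t != 0.
  move=> Cxi; have /(_ _ Cxi) := @connected_component_sub _ (hyperplane_complement T) xi0.
  by move=> h; apply/eqP => q0; apply: h; exists t.
have itvC : is_interval ((fun xi : 'rV[R]_d.+1 => qpoly xi t) @` C).
  apply/connected_intervalP; apply: connected_continuous_connected.
    exact: component_connected.
  exact/continuous_subspaceT/qpoly_continuous.
have cl e : C `<=` [set xi | 0 <= e * qpoly xi t] ->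
    closure C `<=` [set xi | 0 <= e * qpoly xi t].
  move=> sub xi clxi; rewrite /= leNgt; apply/negP => neg.
  have ce : e * qpoly z t @[z --> xi] --> e * qpoly xi t.
    by apply: (@cvgMl_tmp _ _ (nbhs xi) _ (fun z => qpoly z t)); exact: qpoly_continuous.
  have [z [/sub /= + /=]] := clxi _ (cvgr_lt _ ce _ neg).
  by rewrite leNgt => /negP.
have [[xi1 Cxi1 pos]|npos] := pselect (exists2 xi, C xi & 0 < qpoly xi t).
  exists 1; first by rewrite oner_eq0.
  apply: cl => xi Cxi /=; rewrite mul1r leNgt; apply/negP => neg.
  have [|||z Cz zq] := itvC (qpoly xi t) (qpoly xi1 t) _ _ 0.
  - by exists xi.
  - by exists xi1.
  - by rewrite !ltW.
  by have := Cq _ Cz; rewrite zq eqxx.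
exists (-1); first by rewrite oppr_eq0 oner_eq0.
apply: cl => xi Cxi /=; rewrite mulN1r oppr_ge0 leNgt.
by apply/negP => ?; apply: npos; exists xi.
Qed.

(** If the value at [t] were 0, small changes of the constant coefficient would give it both signs
    inside the chamber. *)
Lemma interior_chamber_neq0 T sigma xi t :
  is_chamber T sigma -> interior sigma xi -> t \in T -> qpoly xi t != 0.
Proof.
move=> [xi0 _ ->] int tT; have [e e0 sub] := closure_component_sign xi0 tT.
apply/eqP => q0.
pose h (a : R) : 'rV[R]_d.+1 := xi + a *: delta_mx 0 0.
have qh a : qpoly (h a) t = a.
  rewrite -[RHS]add0r -[X in X + a]q0 /qpoly /h.
  under eq_bigr do rewrite !mxE mulrDl.
  rewrite big_split /=; congr (_ + _).
  rewrite big_ord_recl /= big1 => [|i _]; last by rewrite mulr0 mul0r.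
  by rewrite expr0 !mulr1 addr0.
have ch : h a @[a --> (0 : R)] --> xi.
  rewrite -[X in _ --> X]addr0; apply: cvgD; first exact: cvg_cst.
  by rewrite -[X in _ --> X](scale0r (delta_mx 0 0)); apply: cvgZr_tmp; exact: cvg_id.
have /nbhs_ballP[r /= r0 hr] : \forall a \near (0 : R), 0 <= e * a.
  by near=> a; rewrite -(qh a); apply: sub; near: a; exact: ch.
(* A shift within the radius whose sign is opposite to that of [e]. *)
have : ball 0 r (- Num.sg e * (r / 2)).
  rewrite /ball /= sub0r normrN normrM normrN normr_sg e0 mul1r.
  by rewrite gtr0_norm ?divr_gt0// gtr_pMr// invf_lt1// ltr1n.
move=> /hr /=; rewrite leNgt mulNr mulrN mulrA [e * _]mulrC -normrEsg oppr_lt0.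
by rewrite mulr_gt0 ?normr_gt0 ?divr_gt0.
Unshelve. all: by end_near. Qed.

End Chambers.

(** * Linear functionals as polynomials *)

Lemma horner_rVpoly (R : realType) d (xi : 'rV[R]_d.+1) t :
  (rVpoly xi).[t] = qpoly xi t.
Proof.
rewrite (horner_coef_wide _ (size_poly _ _)).
by apply: eq_bigr => i _; rewrite coef_rVpoly_ord.
Qed.

Lemma generating_point_mulmx (R : realType) d (xi : 'rV[R]_d.+1) (c : 'cV_d.+1) t :
  (generating_point xi t *m c) 0 0 = (qpoly xi t)^-1 * (rVpoly c^T).[t].
Proof.
rewrite -scalemxAl mxE mxE horner_rVpoly; congr (_ * _).
by apply: eq_bigr => i _; rewrite !mxE mulrC.
Qed.

(** Coordinate 0 determines the value of [q_xi], and coordinate 1, present since [d] is positive,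
    then determines the parameter. *)
Lemma generating_point_inj (R : realType) d (xi : 'rV[R]_d.+1) t u :
  (0 < d)%N -> qpoly xi t != 0 ->
  generating_point xi t = generating_point xi u -> t = u.
Proof.
case: d xi => // d xi _ qt0 /rowP e.
have := e ord0; rewrite !mxE !expr0 !mulr1 => /invr_inj qE.
have := e (lift ord0 ord0); rewrite !mxE -qE /= !expr1.
by move/mulfI; apply; rewrite invr_eq0.
Qed.

Lemma vertex_generating_pointP (R : realType) d (T : seq R) (xi : 'rV[R]_d.+1) t :
  (0 < d)%N -> {in T, forall u, qpoly xi u != 0} -> t \in T ->
  is_vertex (veronese_polytope T xi) (generating_point xi t) <->
  exists f : {poly R}, [/\ (size f <= d.+1)%N, root f t &
    {in T, forall u, u != t -> Num.sg f.[u] = Num.sg (qpoly xi u)}].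
Proof.
move=> d0 q0 tT; split=> [/is_vertex_hullP[_ [c hc]]|[f [szf ft hf]]].
  pose b := (generating_point xi t *m c) 0 0.
  (* Divided by [q_xi], this is [b] minus the functional, which is 0 at [t] and positive at the
     other points. *)
  exists (b *: rVpoly xi - rVpoly c^T); split.
  - rewrite (leq_trans (size_polyD _ _))// size_polyN geq_max size_poly andbT.
    by rewrite (leq_trans (size_scale_leq _ _))// size_poly.
  - rewrite /root hornerD hornerN hornerZ horner_rVpoly subr_eq0.
    by rewrite /b generating_point_mulmx mulrAC mulVf ?mul1r// q0.
  move=> u uT ut.
  have gut : generating_point xi u != generating_point xi t.
    by apply: contra_neq ut; apply: generating_point_inj; rewrite ?q0.
  have := hc _ (ex_intro2 _ _ u uT erefl) gut.
  rewrite -/b generating_point_mulmx -subr_gt0 => pos.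
  rewrite hornerD hornerN hornerZ horner_rVpoly.
  have -> : b * qpoly xi u - (rVpoly c^T).[u] =
      qpoly xi u * (b - (qpoly xi u)^-1 * (rVpoly c^T).[u]).
    by rewrite mulrBr mulrA mulfV ?q0// mul1r mulrC.
  by rewrite sgrM (gtr0_sg pos) mulr1.
apply/is_vertex_hullP; split; first by exists t.
(* This functional takes the value [- f / q_xi]: 0 at [t] and negative elsewhere. *)
exists (- (poly_rV f)^T) => _ [u uT <-] gut.
have ut : u != t by apply: contra_neq gut => ->.
rewrite !generating_point_mulmx linearN /= trmxK linearN /= poly_rV_K // !hornerN.
rewrite (eqP ft) oppr0 mulr0 mulrN oppr_lt0 -sgr_cp0 sgrM sgrV hf //.
by rewrite -expr2 sqr_sg q0.
Qed.

(** * Dividers as sign changes *)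

Section Dividers.
Variables (R : realType) (d : nat) (xi : 'rV[R]_d.+1).
Implicit Types (x t : R) (s B : seq R) (I : seq (seq R)).
Local Notation q := (qpoly xi).

Lemma sign_changes_cat x s1 s2 :
  {in x :: s1 &, forall a b, Num.sg (q a) = Num.sg (q b)} ->
  sign_changes q x (s1 ++ s2) = sign_changes q (last x s1) s2.
Proof.
elim: s1 x => //= y s1 ih x hc; rewrite (hc x y) ?inE ?eqxx ?orbT // ih //.
by move=> a b ain bin; apply: hc; rewrite inE ?ain ?bin orbT.
Qed.

(** No sign change occurs within a run and exactly one between neighbouring runs. The indexing is
    that of [dividers]. *)
Lemma sign_changes_flatten B I :
  [::] \notin B :: I ->
  {in B :: I, forall B, {in B &, forall a b, Num.sg (q a) = Num.sg (q b)}} ->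
  path (fun A B => Num.sg (q (last 0 A)) != Num.sg (q (head 0 B))) B I ->
  sign_changes q (head 0 B) (behead (flatten (B :: I))) =
  mkseq (fun j => (last 0 (nth [::] (B :: I) j), head 0 (nth [::] (B :: I) j.+1)))
    (size I).
Proof.
elim: I B => [|C I ih] [|b B] //= hn hc.
  by rewrite sign_changes_cat //; apply: hc; rewrite mem_head.
have hn' : [::] \notin C :: I by apply: contra hn => h; rewrite in_cons h orbT.
move=> /andP[hbC hI]; rewrite sign_changes_cat; last by apply: hc; rewrite mem_head.
case: C hn hn' hc hbC hI => [|c C] hn hn' hc hbC hI; first by rewrite mem_head in hn'.
rewrite /= (negPf hbC) /mkseq /= -[iota 1 _]/(iota (1 + 0) _) iotaDl -map_comp.
congr (_ :: _); have /= -> := ih (c :: C) => //.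
by move=> A AI; apply: hc; rewrite inE AI orbT.
Qed.

Lemma last_flatten y B I : [::] \notin B :: I ->
  last y (flatten (B :: I)) = last y (last B I).
Proof.
elim: I y B => [|C I ih] y B hn; first by rewrite /= cats0.
have hn' : [::] \notin C :: I by apply: contra hn => h; rewrite in_cons h orbT.
rewrite /= last_cat [LHS]ih //.
by case: (last C I) (mem_last C I) => // /(negP hn').
Qed.

Variables (S : finType) (tau : R -> S).

(** The wrapping pair is listed in increasing order, as the inner pairs are, so that a pair can be
    recovered from its divider. *)
Definition circular_changes x s : seq (R * R) :=
  let sc := sign_changes q x s in
  sc ++ if odd d != odd (size sc) then [:: (x, last x s)] else [::].

Definition divider (p : R * R) : {set S} := [set tau p.1; tau p.2]%SET.

(** There is one more run than there are sign changes, so the two parity tests agree. *)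
Lemma mem_dividers x s I : is_signed_decomposition (x :: s) xi I ->
  dividers d I tau =i map divider (circular_changes x s).
Proof.
case: I => [[]//|[|x' B] I] [fl hn hc hs] E; first by rewrite mem_head in hn.
have [ex es] : x' = x /\ B ++ flatten I = s by case: fl.
have sc : sign_changes q x s = mkseq (fun j =>
    (last 0 (nth [::] ((x' :: B) :: I) j),
     head 0 (nth [::] ((x' :: B) :: I) j.+1))) (size I).
  by rewrite -(sign_changes_flatten hn hc hs) /= es ex.
have lastE : last x s = last 0 (nth [::] ((x' :: B) :: I) (size I)).
  rewrite -[size I]/(size ((x' :: B) :: I)).-1 nth_last /=.
  rewrite -[LHS]/(last 0 (x :: s)) -fl last_flatten //=.
rewrite /dividers /circular_changes sc size_mkseq map_cat mem_cat finset.in_setU /=.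
congr (_ || _).
  rewrite -map_comp; apply/imsetP/mapP => [[j _ ->]|[j]].
    by exists (val j) => //; rewrite mem_iota add0n; exact: ltn_ord.
  by rewrite mem_iota /= => jI ->; exists (Ordinal jI).
by case: ifP => _; rewrite ?inE // lastE /divider /= ex finset.setUC.
Qed.

Lemma card_dividers_le x s I : is_signed_decomposition (x :: s) xi I ->
  (#|dividers d I tau| <= (size (sign_changes q x s)).+1)%N.
Proof.
move=> hI; rewrite (eq_card (mem_dividers hI)) (leq_trans (card_size _)) //.
by rewrite size_map size_cat -addn1 leq_add2l; case: ifP.
Qed.

Lemma mem_circular_changes x s p : path <%R x s -> s != [::] ->
  p \in circular_changes x s ->
  [/\ p.1 \in x :: s, p.2 \in x :: s & p.1 < p.2].
Proof.
move=> xs s0; rewrite mem_cat => /orP[/(mem_sign_changes xs)[]//|].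
case: ifP => // _; rewrite inE => /eqP -> /=; rewrite mem_head mem_last; split=> //.
case: s s0 xs => // y s _; rewrite lt_path_sortedE => /andP[/allP + _].
by apply; rewrite /= mem_last.
Qed.

(* If the wrapping pair were also an inner one, [T] would be [{x, last x s}], so
   [d = 1], and one sign change has the parity of [d]: no wrapping pair. *)
Lemma circular_changes_uniq x s : (0 < d)%N -> path <%R x s -> (d <= size s)%N ->
  (d <= (size (sign_changes q x s)).+1)%N -> uniq (circular_changes x s).
Proof.
move=> d0 xs ds dk; rewrite cat_uniq sign_changes_uniq //=.
case: ifP => //= odd_k; rewrite orbF andbT.
apply/negP => xl.
have k0 : (0 < size (sign_changes q x s))%N by case: sign_changes xl.
case: s xs ds dk odd_k xl k0 => [|y [|z s]] // xs ds dk + xl k0.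
  move: k0; rewrite /= (_ : odd d); last by have -> : d = 1%N by apply/eqP; rewrite eqn_leq ds.
  by case: ifP.
move=> _; have := sign_changes_consecutive xs xl (t := y).
rewrite !inE eqxx orbT => /(_ isT) /=.
move: xs => /= /and3P[xy yz zs]; rewrite leNgt xy /= leNgt => /negP; apply.
exact: lt_le_trans yz (le_path_last zs (mem_head _ _)).
Qed.

(** Injectivity of [tau] recovers the two elements, and the order tells which comes first. *)
Lemma divider_inj (T : seq R) p1 p2 : {in T &, injective tau} ->
  p1.1 \in T -> p1.2 \in T -> p2.1 \in T -> p2.2 \in T ->
  p1.1 < p1.2 -> p2.1 < p2.2 -> divider p1 = divider p2 -> p1 = p2.
Proof.
case: p1 p2 => [u1 v1] [u2 v2] /= inj hu1 hv1 hu2 hv2 lt1 lt2 /setP e.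
have mem w : w \in T -> ((w == u1) || (w == v1)) = ((w == u2) || (w == v2)).
  by move=> wT; have := e (tau w); rewrite !inE !(inj_in_eq inj).
have := mem u1 hu1; have := mem v1 hv1; rewrite !eqxx orbT /=.
move=> /esym/orP[/eqP ev|/eqP ev] /esym/orP[/eqP eu|/eqP eu]; subst => //.
- by rewrite ltxx in lt1.
- by have := lt_trans lt1 lt2; rewrite ltxx.
- by rewrite ltxx in lt1.
Qed.

Lemma card_dividers x s I : is_signed_decomposition (x :: s) xi I ->
  (0 < d)%N -> path <%R x s -> s != [::] -> (d <= size s)%N -> {in x :: s &, injective tau} ->
  (d <= (size (sign_changes q x s)).+1)%N ->
  #|dividers d I tau| = size (circular_changes x s).
Proof.
move=> hI d0 xs s0 ds inj dk; rewrite (eq_card (mem_dividers hI)).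
rewrite -(size_map divider); apply/card_uniqP.
rewrite map_inj_in_uniq ?circular_changes_uniq // => p1 p2 h1 h2.
have [a1 b1 c1] := mem_circular_changes xs s0 h1.
have [a2 b2 c2] := mem_circular_changes xs s0 h2.
exact: divider_inj inj _ _ _ _ _ _.
Qed.

End Dividers.

Lemma neg_neqb (b : bool) : ((~~ b) != b) = true.
Proof. by case: b. Qed.

(** * Vertex criteria in terms of sign changes *)

Section VertexCriteria.
Variables (R : realType) (d : nat) (x : R) (s : seq R) (xi : 'rV[R]_d.+1).
Local Notation q := (qpoly xi).
Local Notation T := (x :: s).
Local Notation sc := (sign_changes q x s).
Hypotheses (d_gt0 : (0 < d)%N) (xs : path <%R x s) (s0 : s != [::]).
Hypothesis q_neq0 : {in T, forall t, q t != 0}.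

Lemma sign_change_lt0 (f : {poly R}) p :
  (forall u, u \in [:: p.1; p.2] -> Num.sg f.[u] = Num.sg (q u)) ->
  p \in sc -> f.[p.1] * f.[p.2] < 0.
Proof.
move=> hf pin; have [h1 h2 _] := mem_sign_changes xs pin.
rewrite -sgr_cp0 sgrM !hf ?inE ?eqxx ?orbT //.
move: (q_neq0 h1) (q_neq0 h2).
by case: (sgrP (q p.1)); case: (sgrP (q p.2)); rewrite ?eqxx // ?mulrN1 ?mulN1r.
Qed.

(** The nonzero polynomial [q_xi], of degree at most [d], has a root in each gap. *)
Lemma size_sign_changes_le : (size sc <= d)%N.
Proof.
have hf p : p \in sc -> (rVpoly xi).[p.1] * (rVpoly xi).[p.2] < 0.
  by apply: sign_change_lt0 => u _; rewrite horner_rVpoly.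
have [g [_ rg ug]] := sign_changes_roots xs hf.
rewrite -(size_map g) -ltnS (leq_trans _ (size_poly _ _ : (size (rVpoly xi) <= _)%N)) //.
apply: max_poly_roots rg ug; apply: contra_neq (q_neq0 (mem_head x s)).
by rewrite -horner_rVpoly => ->; rewrite horner0.
Qed.

(** The separating polynomial is [h] times one linear factor per gap, up to sign. The root at [t]
    comes from [h] or from a gap ending at [t]. *)
Lemma separating_poly_vertex (h : {poly R}) t : t \in T ->
  (size h + size sc <= d.+1)%N ->
  {in T, forall u, u != t -> 0 < h.[u]} ->
  root h t \/ (exists2 p, p \in sc & (t == p.1) || (t == p.2)) ->
  is_vertex (veronese_polytope T xi) (generating_point xi t).
Proof.
move=> tT szh hpos hroot; apply/vertex_generating_pointP => //.
pose g (p : R * R) := if (t == p.1) || (t == p.2) then t else (p.1 + p.2) / 2.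
have hg p : p \in sc -> p.1 <= g p <= p.2 /\ (g p = t \/ p.1 < g p < p.2).
  case/(mem_sign_changes xs) => _ _ lt_p _; rewrite /g; case: ifP => [/orP[]/eqP tp|_].
  - by rewrite {1 2}tp lexx ltW //; split=> //; left.
  - by rewrite {1 2}tp lexx ltW //; split=> //; left.
  by rewrite !midf_le ?midf_lt ?(ltW lt_p) //; split=> //; right.
(* This is the constant of [sgr_prod_sign_changes]; it is 1 or -1, so multiplying by it again
   cancels it. *)
have [e eE] : exists e : R, e = (-1) ^+ size sc * Num.sg (q x).
  by exists ((-1) ^+ size sc * Num.sg (q x)).
have norm_e : `|e| = 1.
  by rewrite eE normrM normrX normrN1 expr1n mul1r normr_sg q_neq0 ?mem_head.
exists (e *: (h * \prod_(p <- sc) ('X - (g p)%:P))); split.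
- rewrite (leq_trans (size_scale_leq _ _)) // (leq_trans (size_polyMleq _ _)) //.
  by rewrite size_prod_XsubC addnS.
- rewrite rootZ ?rootM; last first.
    by rewrite -normr_eq0 norm_e oner_eq0.
  case: hroot => [->//|[p pin tp]]; apply/orP; right.
  rewrite -[\prod_(_ <- _) _](big_map g predT (fun r => 'X - r%:P)) root_prod_XsubC.
  by apply/mapP; exists p => //; rewrite /g tp.
move=> u uT ut; rewrite hornerZ hornerM horner_prod.
under eq_bigr do rewrite hornerXsubC.
rewrite !sgrM (gtr0_sg (hpos u uT ut)) mul1r sgr_prod_sign_changes //.
- by rewrite -eE mulrA -normrEsg norm_e mul1r.
- by move=> p /hg[].
move=> p pin; have [_ [->//|/andP[g1 g2]]] := hg _ pin.
apply/eqP => ug; have := sign_changes_consecutive xs pin uT.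
by rewrite ug leNgt g1 /= leNgt g2.
Qed.

(** If [t] is in no pair, the separating polynomial keeps the signs of [q] at both ends of each gap,
    hence has a root in every gap besides [t]. *)
Lemma vertex_mem_circular_changes t : t \in T -> (d <= (size sc).+1)%N ->
  is_vertex (veronese_polytope T xi) (generating_point xi t) ->
  exists2 p, p \in circular_changes xi x s & (t == p.1) || (t == p.2).
Proof.
move=> tT dk /vertex_generating_pointP[]// f [szf ft hf].
apply: contrapT => nex.
have nt p : p \in circular_changes xi x s -> p.1 != t /\ p.2 != t.
  move=> pin; apply/andP; rewrite -negb_or ![_ == t]eq_sym.
  by apply/negP => tp; apply: nex; exists p.
have nsc p : p \in sc -> p.1 != t /\ p.2 != t.
  by move=> pin; apply: nt; rewrite mem_cat pin.
have [||g [hg rg ug]] := @sign_changes_roots R q x s f => //.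
  move=> p pin; apply: (sign_change_lt0 _ pin) => u.
  have [h1 h2 _ _] := mem_sign_changes xs pin; have [n1 n2] := nsc _ pin.
  by rewrite !inE => /orP[]/eqP ->; apply: hf.
have utg : uniq (t :: map g sc).
  rewrite cons_uniq ug andbT; apply/mapP => -[p pin tg].
  have /andP[g1 g2] := hg _ pin; have := sign_changes_consecutive xs pin tT.
  by rewrite tg leNgt g1 /= leNgt g2.
have rtg : all (root f) (t :: map g sc) by rewrite /= ft.
have [u uT ut] : exists2 u, u \in T & u != t.
  have [tx|] := eqVneq x t; last by exists x => //; exact: mem_head.
  case: s s0 xs => // y s' _ /andP[xy _]; exists y; first by rewrite !inE eqxx orbT.
  by rewrite -tx gt_eqF.
have f0 : f != 0.
  apply: contra_neq (q_neq0 uT) => f0; apply/eqP.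
  by rewrite -sgr_eq0 -hf // f0 horner0 sgr0.
have := max_poly_roots f0 rtg utg; rewrite /= size_map => lt_f.
(* The root count excludes [k = d]. The parities of [d] and [k] then differ, so the wrapping pair is
   present and [t] is not extreme in [T]. *)
have szk : d = (size sc).+1 by apply/eqP; rewrite eqn_leq dk -ltnS (leq_trans lt_f).
have odd_d : odd d = ~~ odd (size sc) by have := congr1 odd szk.
have xl : (x, last x s) \in circular_changes xi x s.
  by rewrite mem_cat odd_d neg_neqb mem_head orbT.
have [/= xt lt] := nt _ xl.
have x_lt_t : x < t.
  move: tT; rewrite inE eq_sym (negPf xt) => /= ts.
  by move: xs; rewrite lt_path_sortedE => /andP[/allP/(_ _ ts)].
have t_lt_l : t < last x s.
  by rewrite lt_neqAle eq_sym lt le_path_last.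
(* The known roots are as many as the degree, so [f] splits. *)
have fE : f = lead_coef f *: \prod_(z <- t :: map g sc) ('X - z%:P).
  apply: all_roots_prod_XsubC => //; last by rewrite uniq_rootsE.
  by apply/eqP; rewrite eqn_leq /= size_map lt_f andbT -szk szf.
(* The inner roots already account for the signs of [q], so [u - t] would have
   to keep a constant sign over [T]. *)
have hsg u' : u' \in T -> u' != t ->
    Num.sg (lead_coef f) * (-1) ^+ size sc * Num.sg (q x) * Num.sg (u' - t) = 1.
  move=> u'T u't; have sgq : Num.sg (q u') * Num.sg (q u') = 1.
    by rewrite -expr2 sqr_sg q_neq0.
  have fu' : f.[u'] = lead_coef f * ((u' - t) * \prod_(p <- sc) (u' - g p)).
    rewrite {1}fE hornerZ big_cons hornerM horner_prod big_map hornerXsubC.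
    by under eq_bigr do rewrite hornerXsubC.
  rewrite -[RHS]sgq -{1}(hf _ u'T u't) fu' !sgrM sgr_prod_sign_changes //; first last.
  - move=> p pin; have /andP[g1 g2] := hg _ pin.
    apply/eqP => u'g; have := sign_changes_consecutive xs pin u'T.
    by rewrite u'g leNgt g1 /= leNgt g2.
  - by move=> p /hg/andP[/ltW-> /ltW->].
  by rewrite -!mulrA sgq !mulr1; congr (_ * _); rewrite [RHS]mulrC -!mulrA.
(* The two extreme elements of [T] lie on opposite sides of [t], which gives [-1 = 1]. *)
have := hsg _ (mem_head x s) xt; have := hsg _ (mem_last x s) lt.
rewrite (gtr0_sg (_ : 0 < last x s - t)) ?subr_gt0 // mulr1 => ->.
rewrite ltr0_sg ?subr_lt0 // mul1r => /eqP.
by rewrite eq_sym -subr_eq0 opprK (pnatr_eq0 R 2).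
Qed.

(** For an inner pair the gap supplies the root [t] and [h = 1]. For the wrapping pair, [h] is
    [X - t] or [t - X], and the parity test leaves room for this extra degree. *)
Lemma circular_changes_vertex t p : t \in T -> (d <= (size sc).+1)%N ->
  p \in circular_changes xi x s -> (t == p.1) || (t == p.2) ->
  is_vertex (veronese_polytope T xi) (generating_point xi t).
Proof.
move=> tT dk; rewrite mem_cat => /orP[pin tp|].
  apply: (@separating_poly_vertex 1) => //; last by right; exists p.
    by rewrite size_poly1 add1n ltnS size_sign_changes_le.
  by move=> u _ _; rewrite hornerC.
case: ifP => // odd_k; rewrite inE => /eqP -> /= {p}.
have kd : (size sc < d)%N.
  rewrite ltn_neqAle size_sign_changes_le andbT.
  by apply: contraTneq odd_k => ->; rewrite eqxx.
case/orP => /eqP te.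
  apply: (@separating_poly_vertex ('X - t%:P)) => //.
  - by rewrite size_XsubC add2n ltnS.
  - move=> u uT ut; rewrite hornerXsubC subr_gt0 te.
    move: uT; rewrite inE -te (negPf ut) => /= us.
    by move: xs; rewrite te lt_path_sortedE => /andP[/allP/(_ _ us)].
  - by left; rewrite root_XsubC.
apply: (@separating_poly_vertex (t%:P - 'X)) => //.
- by rewrite -opprB size_polyN size_XsubC add2n ltnS.
- move=> u uT ut; rewrite -opprB hornerN hornerXsubC oppr_gt0 subr_lt0 te.
  by rewrite lt_neqAle -te ut te le_path_last.
- by left; rewrite -opprB rootN root_XsubC.
Qed.

(** There is room for the square of [X - t], which is positive away from [t]. *)
Lemma few_changes_vertex t : t \in T -> ((size sc).+1 < d)%N ->
  is_vertex (veronese_polytope T xi) (generating_point xi t).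
Proof.
move=> tT kd; apply: (@separating_poly_vertex (('X - t%:P) ^+ 2)) => //.
- by rewrite size_exp_XsubC !addSn add0n ltnS.
- by move=> u _ ut; rewrite horner_exp hornerXsubC exprn_even_gt0 //= subr_eq0.
by left; rewrite root_exp_XsubC.
Qed.

End VertexCriteria.

(** * Number of dividers compared with [d] *)

Theorem theorem3p16 (R : realType) (d : nat) (T : seq R)
    (sigma : set 'rV[R]_d.+1) (xi : 'rV[R]_d.+1)
    (S : finType) (c : S -> S -> S -> bool) (D : {set {set S}}) (tau : R -> S)
    (hd : (1 <= d)%N)
    (hT : sorted <%R T) (hn : (d.+1 <= size T)%N)
    (hsigma : is_chamber T sigma) (hxi : interior sigma xi)
    (hind : is_induced_circular_composition T xi c D tau) :
  ((#|D| < d)%N ->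
     forall t, t \in T ->
       is_vertex (veronese_polytope T xi) (generating_point xi t)) /\
  (#|D| = d ->
     [set v | is_vertex (veronese_polytope T xi) v] =
     [set generating_point xi t
        | t in [set t | t \in T /\ exists2 E : {set S}, E \in D & tau t \in E]]).
Proof.
have q_neq0 t : t \in T -> qpoly xi t != 0.
  exact: interior_chamber_neq0 hsigma hxi.
case: hind => _ [inj _ _] [I hI DE].
case: T hT hn hsigma q_neq0 inj hI => [//|x s] /= xs ds _ q_neq0 inj hI.
have s0 : s != [::] by case: s ds {xs q_neq0 inj hI} => //; rewrite ltnS leqNgt hd.
pose k := size (sign_changes (qpoly xi) x s).
have memD p : p \in circular_changes xi x s -> divider tau p \in D.
  by move=> pin; rewrite DE (mem_dividers tau hI) map_f.
split=> [Dd t tT|Dd].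
  (* If [d <= k + 1], then [k] is [d] or [d - 1]; in the latter case parity adds the wrapping pair.
     Either way there are at least [d] dividers, a contradiction. *)
  have [dk|kd] := leqP d k.+1; last exact: few_changes_vertex.
  move: Dd; rewrite ltnNge; case/negP.
  rewrite DE (card_dividers hI) // size_cat -/k.
  have kd := size_sign_changes_le xs q_neq0.
  have [->|nk] := eqVneq k d; first by rewrite leq_addr.
  have dE : d = k.+1 by apply/eqP; rewrite eqn_leq dk ltn_neqAle nk.
  by rewrite (congr1 odd dE : odd d = ~~ odd k) neg_neqb addn1 -dE.
have dk : (d <= k.+1)%N by rewrite -Dd DE card_dividers_le.
apply/seteqP; split=> [v /= hv|_ [t /= [tT [E ED tE]] <-]].
  have [[t tT te] _] := (is_vertex_hullP _ _).1 hv.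
  rewrite -te in hv *; exists t => //; split=> //.
  have [p pin tp] := vertex_mem_circular_changes hd xs s0 q_neq0 tT dk hv.
  exists (divider tau p); first exact: memD.
  by case/orP: tp => /eqP ->; rewrite !inE eqxx ?orbT.
move: ED; rewrite DE (mem_dividers tau hI) => /mapP[p pin Ep].
have [p1 p2 _] := mem_circular_changes xs s0 pin.
apply: (circular_changes_vertex hd xs q_neq0 tT dk pin).
by move: tE; rewrite Ep !inE !(inj_in_eq inj).
Qed.
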